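(* For every static constant game $A$, both $\mathbf{R}^T A$ and $\mathbf{C}^T A$ are static games; i.e., the tight toggling-branching recurrence and corecurrence operations are static.
   Context: Games (Computability Logic). A move is a finite string; a labmove is a move prefixed by a label $\top$ (machine) or $\bot$ (environment); a run is a finite or infinite sequence of labmoves, and a position is a finite run. For a player $\wp$, $\neg\wp$ denotes the other player. A (constant) game $A$ consists of a set of legal runs, closed under initial segments, where a run is legal iff all its finite initial segments are legal positions, together with a function assigning to each legal run a winner ($\top$ or $\bot$). $\wp\alpha$ is a legal labmove in a legal position $\Phi$ of $A$ (equivalently, $\alpha$ is a legal move by $\wp$ in $\Phi$) iff $\langle\Phi,\wp\alpha\rangle$ is a legal position of $A$. An illegal run is $\wp$-illegal iff its shortest illegal initial segment ends with a $\wp$-labeled move; a $\wp$-illegal run is won by $\neg\wp$. The negation $\neg A$ is obtained by interchanging the labels $\top,\bot$ in all runs (legality and winners). A run $\Delta$ is a $\wp$-delay of a run $\Gamma$ iff (i) for each player, the subsequence of that player's labmoves is the same in $\Delta$ and $\Gamma$, and (ii) for all $n,k\geq 1$, if in $\Gamma$ the $n$th $\neg\wp$-labeled move is made later than the $k$th $\wp$-labeled move, then the same holds in $\Delta$. A game $A$ is static iff whenever a run $\Gamma$ is won by $\wp$ and $\Delta$ is a $\wp$-delay of $\Gamma$, $\Delta$ is also won by $\wp$. Notation. For a run $\Omega$ and an infinite bitstring $v$, $\Omega^{\preceq v}$ is obtained from $\Omega$ by deleting all labmoves except those whose move has the form $u.\alpha$ for some finite initial segment $u$ of $v$ (possibly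 empty), and then deleting the prefix ''$u.$'' from such moves (labels are kept). An actual node of a position $\Omega$ is a finite bitstring that is either empty or is $u0$ or $u1$ where $\Omega$ contains the move $u{:}$ . An actual node is outer iff it is not a proper prefix of another actual node of $\Omega$. Tight toggling-branching recurrence $\mathbf{R}^T A$: legal positions are built inductively from the empty position, and the legal labmoves in a legal position $\Phi$ are: (1) switch moves $\bot w$, where $w$ is an actual node of $\Phi$; (2) replicative moves $\bot w{:}$, where $w$ is an outer actual node of $\Phi$; (3) non-replicative moves $\wp w.\alpha$ (either player $\wp$), where $w$ is an actual node of $\Phi$ and, for every infinite bitstring $v$, $\alpha$ is a legal move by $\wp$ in the position $\Phi^{\preceq wv}$ of $A$. A legal run $\Gamma$ of $\mathbf{R}^T A$ is won by $\bot$ iff $\Gamma$ contains only finitely many switch moves and $\Gamma^{\preceq t}$ is a $\bot$-won run of $A$, where $t$ is the last switch move of $\Gamma$ with infinitely many $0$s appended (or the infinite string of $0$s if there are no switch moves). The tight toggling-branching corecurrence is $\mathbf{C}^T A=\neg\mathbf{R}^T\neg A$ (the same definition with $\top$ and $\bot$ interchanged).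
   Formalization: A ℘-delay is taken in the standard sense (if the nth ℘-move is later than the kth ¬℘-move in Γ, so it is in Δ), the players being swapped in the given definition; and in every legal position of a game each player is assumed to have some illegal move. The empty run is legal. *)

(* Defs.v *)
From HB Require Import structures.
From Stdlib Require Import Ascii.
From mathcomp Require Import all_boot.
From mathcomp Require Import boolp classical_sets.

Set Implicit Arguments.
Unset Strict Implicit.
Unset Printing Implicit Defensive.

HB.instance Definition _ := hasDecEq.Build ascii Ascii.eqb_spec.

(** * Moves, labmoves, runs *)

(* [true] is the machine, [false] the environment; the other player is [~~ p]. *)
Definition player := bool.
Definition Machine : player := true.
Definition Environment : player := false.

Definition move := seq ascii.
Definition labmove := (player * move)%type.
Definition position := seq labmove.

Inductive run :=
| Fin of position
| Inf of nat -> labmove.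

Definition take_run (n : nat) (r : run) : position :=
  match r with
  | Fin s => take n s
  | Inf f => mkseq f n
  end.

Definition run_at (r : run) (n : nat) : option labmove :=
  match r with
  | Fin s => onth s n
  | Inf f => Some (f n)
  end.

(* Delete the labmoves that [g] maps to [None] and replace every other labmove
   by its image.  The result on an infinite run is infinite iff infinitely many
   labmoves are kept; [pmap_run_take] and [take_pmap_run] below say that its
   initial segments are those obtained from the initial segments of the run. *)
Definition pmap_run (g : labmove -> option labmove) (r : run) : run :=
  match r with
  | Fin s => Fin (pmap g s)
  | Inf f =>
      let pre k := pmap g (mkseq f k) in
      if `[< forall n, exists k, n < size (pre k) >]
      then Inf (fun n => nth (f 0) (pre (xget 0 [set k | n < size (pre k)])) n)
      else Fin (pre (xget 0 [set k | forall m, k <= m -> pre m = pre k]))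
  end.

Definition flip_label (l : labmove) : labmove := (~~ l.1, l.2).

Definition neg_run (r : run) : run :=
  match r with
  | Fin s => Fin (map flip_label s)
  | Inf f => Inf (flip_label \o f)
  end.

(** * Games *)

(* [Wn] is only meaningful on legal runs; illegal runs are dealt with in
   [won_by].  [illegal_move_exists] is a consequence of the convention of
   computability logic that a special move never occurs in a legal run. *)
Record game := Game {
  Lr : run -> Prop;
  Wn : run -> player;
  Lr_nil : Lr (Fin [::]);
  LrP : forall r, Lr r <-> forall n, Lr (Fin (take_run n r));
  illegal_move_exists : forall (s : position) (p : player),
    Lr (Fin s) -> exists a : move, ~ Lr (Fin (rcons s (p, a)))
}.

Definition legal_move (A : game) (s : position) (p : player) (a : move) : Prop :=
  Lr A (Fin (rcons s (p, a))).

(* As legality is closed under initial segments, an illegal initial segment is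
   the shortest one iff it becomes legal when its last labmove is removed. *)
Definition illegal_by (A : game) (p : player) (r : run) : Prop :=
  exists n s a,
    [/\ take_run n r = rcons s (p, a), Lr A (Fin s)
      & ~ Lr A (Fin (rcons s (p, a)))].

Definition won_by (A : game) (p : player) (r : run) : Prop :=
  (Lr A r /\ Wn A r = p) \/ illegal_by A (~~ p) r.

(** * Static games *)

Definition player_moves (p : player) (r : run) : run :=
  pmap_run (fun l => if l.1 == p then Some l else None) r.

(* The labmove at (0-based) index [i] of [r] is the [n]th (counting from 1)
   [p]-labeled one. *)
Definition nth_move_at (p : player) (n : nat) (r : run) (i : nat) : Prop :=
  (exists a, run_at r i = Some (p, a)) /\
  count (fun l : labmove => l.1 == p) (take_run i.+1 r) = n.

Definition later (r : run) (p : player) (n : nat) (q : player) (k : nat) : Prop :=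
  exists i j, [/\ nth_move_at p n r i, nth_move_at q k r j & j < i].

(* [d] is a [p]-delay of [r]: relative to the adversary's moves, the moves of
   [p] may only be postponed. *)
Definition delay (p : player) (d r : run) : Prop :=
  (forall q, player_moves q d = player_moves q r) /\
  (forall n k, 0 < n -> 0 < k -> later r p n (~~ p) k -> later d p n (~~ p) k).

Definition static (A : game) : Prop :=
  forall (p : player) (r d : run), won_by A p r -> delay p d r -> won_by A p d.

(** * Nodes and the operation [r ^{<= v}] *)

Definition bit_char (b : bool) : ascii := if b then "1"%char else "0"%char.
Definition dot : ascii := ascii_of_nat 46.
Definition colon : ascii := ":"%char.

Definition switch_move (w : seq bool) : move := map bit_char w.
Definition repl_move (w : seq bool) : move := rcons (map bit_char w) colon.
Definition node_move (w : seq bool) (a : move) : move :=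
  map bit_char w ++ dot :: a.

(* The infinite bitstring [w v]. *)
Definition cat_bits (w : seq bool) (v : nat -> bool) : nat -> bool :=
  fun n => if n < size w then nth false w n else v (n - size w).

(* [strip v m] is [Some a] if [m] is [u], a dot, and [a], for some finite initial
   segment [u] of [v], and is [None] if [m] has no such form; see [stripP]. *)
Fixpoint strip (v : nat -> bool) (m : move) : option move :=
  match m with
  | [::] => None
  | c :: m' =>
      if c == dot then Some m'
      else if c == bit_char (v 0) then strip (fun n => v n.+1) m'
      else None
  end.

Definition strip_lab (v : nat -> bool) (l : labmove) : option labmove :=
  omap (pair l.1) (strip v l.2).

Definition restrict (r : run) (v : nat -> bool) : run := pmap_run (strip_lab v) r.
Definition restrict_pos (s : position) (v : nat -> bool) : position :=
  pmap (strip_lab v) s.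

Definition actual_node (s : position) (w : seq bool) : Prop :=
  w = [::] \/ exists u b p, w = rcons u b /\ (p, repl_move u) \in s.

Definition outer_node (s : position) (w : seq bool) : Prop :=
  actual_node s w /\
  ~ exists w', [/\ actual_node s w', prefix w w' & w != w'].

(** * Helper facts *)

Lemma mkseq_shift (v : nat -> bool) (n : nat) :
  mkseq v n.+1 = v 0 :: mkseq (fun i => v i.+1) n.
Proof. by rewrite /mkseq /= -[1]/(1 + 0) iotaDl -map_comp. Qed.

Lemma stripP (v : nat -> bool) (m a : move) :
  strip v m = Some a <-> exists n, m = node_move (mkseq v n) a.
Proof.
have bit_dot b : bit_char b <> dot by case: b.
elim: m v => [|c m IH] v /=.
  by split=> // -[n]; rewrite /node_move; case: (map _ _).
have [->|/eqP cd] := eqVneq c dot.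
  split=> [[->]|[[|n]]]; first by exists 0.
    by case=> ->.
  by rewrite mkseq_shift => -[/esym/bit_dot].
have [->|/eqP cb] := eqVneq c (bit_char (v 0)).
  split=> [/IH[n ->]|[[|n]]]; first by exists n.+1; rewrite mkseq_shift.
    by case=> /bit_dot.
  by rewrite mkseq_shift => -[em]; apply/IH; exists n.
by split=> // -[[|n]]; [case=> /cd | rewrite mkseq_shift => -[/cb]].
Qed.

Lemma take_take_run (m n : nat) (r : run) :
  m <= n -> take m (take_run n r) = take_run m r.
Proof.
case: r => [s|f] mn /=; first exact: take_takel.
by rewrite /mkseq -map_take take_iota; move/minn_idPl: mn => ->.
Qed.

Lemma pmap_pre_le (g : labmove -> option labmove) (f : nat -> labmove) (m n : nat) :
  m <= n ->
  take (size (pmap g (mkseq f m))) (pmap g (mkseq f n)) = pmap g (mkseq f m).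
Proof.
move=> /subnKC <-; rewrite /mkseq iotaD map_cat pmap_cat.
by rewrite take_size_cat.
Qed.

Lemma pmap_run_take (g : labmove -> option labmove) (r : run) (n : nat) :
  exists k, take_run k (pmap_run g r) = pmap g (take_run n r).
Proof.
case: r => [s|f] /=.
  exists (size (pmap g (take n s))).
  by rewrite -{2}(cat_take_drop n s) pmap_cat take_size_cat.
case: asboolP => [unb|bd] /=.
  exists (size (pmap g (mkseq f n))); apply: (@eq_from_nth _ (f 0)).
    by rewrite size_mkseq.
  move=> i; rewrite size_mkseq => ilt; rewrite nth_mkseq //.
  case: xgetP => [k _ /= ik|/(_ n)//].
  by case/orP: (leq_total k n) => /(pmap_pre_le g f) <-; rewrite nth_take.
exists (size (pmap g (mkseq f n))).
case: xgetP => [k _ /= hk|nok].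
  case/orP: (leq_total k n) => [/hk->|/(pmap_pre_le g f)//].
  by rewrite take_size.
exfalso; apply: bd => m; apply: contrapT => nom.
have bnd k : size (pmap g (mkseq f k)) <= m.
  by rewrite leqNgt; apply/negP => h; apply: nom; exists k.
have ex : exists i, `[< exists k, size (pmap g (mkseq f k)) = i >].
  by exists (size (pmap g (mkseq f 0))); apply/asboolP; exists 0.
have ub i : `[< exists k, size (pmap g (mkseq f k)) = i >] -> i <= m.
  by move=> /asboolP[k <-].
case: (ex_maxnP ex ub) => i /asboolP[k ki] imax.
apply: (nok k) => j kj; have := pmap_pre_le g f kj => e.
rewrite -[RHS]e take_oversize // ki.
by apply: imax; apply/asboolP; exists j.
Qed.

Lemma take_pmap_run (g : labmove -> option labmove) (r : run) (k : nat) :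
  exists n, take_run k (pmap_run g r) = take k (pmap g (take_run n r)).
Proof.
case: r => [s|f] /=; first by exists (size s); rewrite take_size.
case: asboolP => [unb|bd] /=; last by eexists; reflexivity.
have [n kn] := unb k; exists n; apply: (@eq_from_nth _ (f 0)).
  by rewrite size_mkseq size_takel // ltnW.
move=> i; rewrite size_mkseq => ilt; rewrite nth_mkseq // nth_take //.
case: xgetP => [j _ /= ij|/(_ n)/=]; last by rewrite (ltn_trans ilt kn).
have ilt' := ltn_trans ilt kn.
by case/orP: (leq_total j n) => /(pmap_pre_le g f) <-; rewrite nth_take.
Qed.

(** * Negation *)

Lemma flip_labelK : involutive flip_label.
Proof. by case=> p a; rewrite /flip_label /= negbK. Qed.

Lemma take_neg_run (n : nat) (r : run) :
  take_run n (neg_run r) = map flip_label (take_run n r).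
Proof. by case: r => [s|f] /=; rewrite ?map_take // /mkseq -map_comp. Qed.

Definition neg_Lr (A : game) (r : run) : Prop := Lr A (neg_run r).
Definition neg_Wn (A : game) (r : run) : player := ~~ Wn A (neg_run r).

Lemma neg_LrP (A : game) (r : run) :
  neg_Lr A r <-> forall n, neg_Lr A (Fin (take_run n r)).
Proof.
by split=> [/LrP h n|h]; [|apply/LrP=> n]; have := h n;
   rewrite /neg_Lr /= take_neg_run.
Qed.

Lemma neg_illegal (A : game) (s : position) (p : player) :
  neg_Lr A (Fin s) -> exists a : move, ~ neg_Lr A (Fin (rcons s (p, a))).
Proof.
move=> /(@illegal_move_exists A _ (~~ p))[a na]; exists a.
by rewrite /neg_Lr /= map_rcons.
Qed.

Definition neg (A : game) : game :=
  @Game (neg_Lr A) (neg_Wn A) (Lr_nil A) (neg_LrP A) (@neg_illegal A).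

(** * Tight toggling-branching recurrence and corecurrence *)

Inductive RT_legal_pos (A : game) : position -> Prop :=
| RT_nil : RT_legal_pos A [::]
| RT_switch s w :
    RT_legal_pos A s -> actual_node s w ->
    RT_legal_pos A (rcons s (Environment, switch_move w))
| RT_repl s w :
    RT_legal_pos A s -> outer_node s w ->
    RT_legal_pos A (rcons s (Environment, repl_move w))
| RT_nonrepl s p w a :
    RT_legal_pos A s -> actual_node s w ->
    (forall v, legal_move A (restrict_pos s (cat_bits w v)) p a) ->
    RT_legal_pos A (rcons s (p, node_move w a)).

Definition RT_Lr (A : game) (r : run) : Prop :=
  forall n, RT_legal_pos A (take_run n r).

Definition switch_at (r : run) (n : nat) (w : seq bool) : Prop :=
  run_at r n = Some (Environment, switch_move w).

Definition finitely_many_switches (r : run) : Prop :=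
  exists N, forall n w, N <= n -> ~ switch_at r n w.

(* With no switch move, [w] is empty, so that [w] followed by zeros is [000...]. *)
Definition last_switch (r : run) (w : seq bool) : Prop :=
  (w = [::] /\ forall n u, ~ switch_at r n u) \/
  (exists n, switch_at r n w /\ forall m u, n < m -> ~ switch_at r m u).

Definition RT_won_by_env (A : game) (r : run) : Prop :=
  finitely_many_switches r /\
  exists w, last_switch r w /\
    won_by A Environment (restrict r (cat_bits w (fun=> false))).

Definition RT_Wn (A : game) (r : run) : player :=
  if `[< RT_won_by_env A r >] then Environment else Machine.

Lemma RT_legal_pos_take (A : game) (s : position) (n : nat) :
  RT_legal_pos A s -> RT_legal_pos A (take n s).
Proof.
have step s' l : RT_legal_pos A (rcons s' l) -> RT_legal_pos A (take n s') ->
    RT_legal_pos A (take n (rcons s' l)).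
  move=> hl ht; case: (ltnP (size s') n) => h.
    by rewrite take_oversize // size_rcons.
  by rewrite -cats1 takel_cat.
elim=> [|s' w hs IH hw|s' w hs IH hw|s' p w a hs IH hw ha]; first exact: RT_nil.
- by apply: step IH; apply: RT_switch.
- by apply: step IH; apply: RT_repl.
- by apply: step IH; apply: RT_nonrepl.
Qed.

Lemma RT_Lr_Fin (A : game) (s : position) :
  RT_Lr A (Fin s) <-> RT_legal_pos A s.
Proof.
split=> [/(_ (size s))|h n]; first by rewrite /= take_size.
exact: RT_legal_pos_take.
Qed.

Lemma RT_Lr_nil (A : game) : RT_Lr A (Fin [::]).
Proof. by apply/RT_Lr_Fin; exact: RT_nil. Qed.

Lemma RT_LrP (A : game) (r : run) :
  RT_Lr A r <-> forall n, RT_Lr A (Fin (take_run n r)).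
Proof. by split=> h n; [apply/RT_Lr_Fin|apply/RT_Lr_Fin/h]. Qed.

Lemma RT_illegal (A : game) (s : position) (p : player) :
  RT_Lr A (Fin s) -> exists a : move, ~ RT_Lr A (Fin (rcons s (p, a))).
Proof.
move=> _; exists [:: "x"%char] => /RT_Lr_Fin h.
suff bad t : RT_legal_pos A t -> forall s', t <> rcons s' (p, [:: "x"%char]).
  exact: bad h s erefl.
case=> [|s' w _ _|s' w _ _|s' q w a _ _ _] s2; first by case: s2.
- by case/rcons_inj=> _ _; case: w => [|[] [|? ?]].
- by case/rcons_inj=> _ _; case: w => [|[] [|? ?]].
- by case/rcons_inj=> _ _; case: w => [|[] [|? ?]].
Qed.

Definition RT (A : game) : game :=
  @Game (RT_Lr A) (RT_Wn A) (RT_Lr_nil A) (RT_LrP A) (@RT_illegal A).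

Definition CT (A : game) : game := neg (RT (neg A)).

(* Main.v *)
(** Compare two legal positions [s] and [t] with the same moves of [~p], [s]
    lacking some of the latest moves of [p] and having its other ones later.  If
    [~p] can legally move [a] after [s], then also after [t]: were [a] illegal after
    [t] in a static game, [p] would win [t, ~p a] even if it went on with a move that
    is illegal in the delayed run, whereas the delayed run is lost by [p].
    This property passes from [A] to its recurrence, since there only the
    environment creates nodes and deleting labmoves preserves delays; and in any
    game it implies that a delay by [p] of a [~p]-illegal run is [~p]-illegal.
    For legal runs, all switches are made by the environment, so a run and its
    delay have the same last switch and their winners are compared inside [A]. *)

Require Import Defs.
From mathcomp Require Import all_boot boolp classical_sets.

Set Implicit Arguments.
Unset Strict Implicit.
Unset Printing Implicit Defensive.

Implicit Types (A G : game) (p q : player) (r d : run) (s t : position).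

(** * Initial segments of runs *)

Lemma take_runS r i :
  take_run i.+1 r =
  if run_at r i is Some l then rcons (take_run i r) l else take_run i r.
Proof.
case: r => [s|f] /=; last by rewrite /mkseq -addn1 iotaD map_cat cats1.
elim: s i => [|l s IH] [|i] //=; first by rewrite take0.
by rewrite IH; case: (onth s i).
Qed.

Lemma size_take_run n r : size (take_run n r) <= n.
Proof. by case: r => [s|f] /=; rewrite ?size_mkseq // size_take_min geq_minl. Qed.

Lemma take_runP r n s l :
  take_run n r = rcons s l -> take_run (size s) r = s /\ run_at r (size s) = Some l.
Proof.
move=> e; have ltn : size s < n.
  by have := size_take_run n r; rewrite e size_rcons.
have es : take_run (size s) r = s.
  by rewrite -(take_take_run r (ltnW ltn)) e -cats1 take_size_cat.
split=> //; have := take_runS r (size s).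
rewrite -(take_take_run r ltn) e take_oversize ?size_rcons // es.
by case: (run_at r _) => [l' /rcons_inj[->]|/(congr1 size)] //;
   rewrite size_rcons => /esym/n_Sn.
Qed.

Lemma prefix_take_run r m n : m <= n -> prefix (take_run m r) (take_run n r).
Proof. by move=> /(take_take_run r) <-; exact: prefix_take. Qed.

Lemma prefix_size_le (T : eqType) (s t u : seq T) :
  prefix s u -> prefix t u -> size s <= size t -> prefix s t.
Proof.
move=> /prefixP[s' eu]; rewrite !prefixE => /eqP et le; apply/eqP.
by rewrite -et take_takel // eu take_size_cat.
Qed.

Lemma prefix_size_eq (T : eqType) (s t : seq T) :
  prefix s t -> size t <= size s -> s = t.
Proof.
move=> /prefixP[[|x s'] ->]; first by rewrite cats0.
by rewrite size_cat /= addnS ltnNge leq_addr.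
Qed.

Lemma run_ext r d : (forall n, take_run n r = take_run n d) -> r = d.
Proof.
have fin_inf s f : (forall n, take_run n (Fin s) = take_run n (Inf f)) -> False.
  move=> /(_ (size s).+1)/(congr1 size) /=.
  by rewrite take_oversize // size_map size_iota => /n_Sn.
case: r d => [s|f] [t|g] h.
- have := h (maxn (size s) (size t)) => /=.
  by rewrite !take_oversize ?leq_maxl ?leq_maxr // => ->.
- by case: (fin_inf _ _ h).
- by case: (@fin_inf t f) => n; rewrite h.
- congr Inf; apply: funext => n.
  have := h n.+1; rewrite !take_runS /= => /rcons_inj[_ ->] //.
Qed.

Definition run_prefix r d : Prop :=
  forall i, exists j, prefix (take_run i r) (take_run j d).

(** Serves finite and infinite runs alike: any index [j] that witnesses a prefix can be brought to
    [n] itself, after which lengths decide. *)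
Lemma run_prefix_anti r d : run_prefix r d -> run_prefix d r -> r = d.
Proof.
have le r1 r2 n : run_prefix r1 r2 -> prefix (take_run n r1) (take_run n r2).
  move=> /(_ n)[j pj].
  have [nj|jn] := leqP n j.
    apply: (prefix_size_le pj (prefix_take_run r2 nj)).
    by rewrite -(take_take_run r2 nj) size_take_min leq_min size_take_run size_prefix.
  exact: prefix_trans pj (prefix_take_run _ (ltnW jn)).
move=> hrd hdr; apply: run_ext => n.
by apply: prefix_size_eq; [exact: le | apply: size_prefix; exact: le].
Qed.

(** * Deleting labmoves *)

Section Pmap.

Variable g : labmove -> option labmove.

Lemma prefix_pmap s t : prefix s t -> prefix (pmap g s) (pmap g t).
Proof. by move=> /prefixP[s' ->]; rewrite pmap_cat prefix_prefix. Qed.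

Lemma take_pmap n s : exists2 m, m <= size s & take n (pmap g s) = pmap g (take m s).
Proof.
elim: s n => [|l s IH] n; first by exists 0.
have [-> | n0] := posnP n; first by exists 0; rewrite // take0.
rewrite /=; case e: (g l) => [l'|] /=.
  by case: n n0 => // n _; have [m ms em] := IH n; exists m.+1 => //=; rewrite e em.
by have [m ms em] := IH n; exists m.+1 => //=; rewrite e em.
Qed.

(** With truncation moved inside [pmap], questions about [pmap_run] become questions about finite
    positions. *)
Lemma take_pmap_runE r k :
  exists n, take_run k (pmap_run g r) = pmap g (take_run n r).
Proof.
have [n ->] := take_pmap_run g r k.
have [m mn ->] := take_pmap k (take_run n r); exists m.
by rewrite take_take_run // (leq_trans mn) // size_take_run.
Qed.

Lemma pmap_run_prefix r d :
  run_prefix (pmap_run g r) (pmap_run g d) <->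
  forall i, exists j, prefix (pmap g (take_run i r)) (pmap g (take_run j d)).
Proof.
split=> h i.
  have [k <-] := pmap_run_take g r i; have [j pj] := h k.
  by have [n en] := take_pmap_runE d j; exists n; rewrite -en.
have [n ->] := take_pmap_runE r i; have [j pj] := h n.
by have [k ek] := pmap_run_take g d j; exists k; rewrite ek.
Qed.

End Pmap.

(** * The subsequence of one player's moves *)

Definition moves_by q s : position := [seq l <- s | l.1 == q].

Lemma pmap_moves_by q s :
  pmap (fun l => if l.1 == q then Some l else None) s = moves_by q s.
Proof. by elim: s => //= l s ->; case: eqP. Qed.

Lemma moves_by_cat q s t : moves_by q (s ++ t) = moves_by q s ++ moves_by q t.
Proof. exact: filter_cat. Qed.

Lemma moves_by_rcons q s l :
  moves_by q (rcons s l) = if l.1 == q then rcons (moves_by q s) l else moves_by q s.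
Proof. exact: filter_rcons. Qed.

Lemma prefix_moves_by q s t : prefix s t -> prefix (moves_by q s) (moves_by q t).
Proof. by move=> /prefixP[s' ->]; rewrite moves_by_cat prefix_prefix. Qed.

Lemma size_moves_by_take_run q r m n :
  m <= n -> size (moves_by q (take_run m r)) <= size (moves_by q (take_run n r)).
Proof. by move=> mn; apply/size_prefix/prefix_moves_by/prefix_take_run. Qed.

Lemma size_moves_by_move q r i a n : run_at r i = Some (q, a) -> i < n ->
  size (moves_by q (take_run i r)) < size (moves_by q (take_run n r)).
Proof.
move=> e lin; apply: leq_trans (size_moves_by_take_run q r lin).
by rewrite take_runS e moves_by_rcons eqxx size_rcons.
Qed.

Lemma nth_move_exists q n m r : 0 < n -> n <= size (moves_by q (take_run m r)) ->
  exists2 i, i < m & nth_move_at q n r i.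
Proof.
move=> n0; elim: m => [|m IH].
  by case: r => [s|f] /=; rewrite ?take0 leqn0 => /eqP en; rewrite en in n0.
rewrite take_runS; case e: (run_at r m) => [[q' a]|]; last first.
  by move=> /IH[i im hi]; exists i => //; exact: ltnW.
rewrite moves_by_rcons /=; case: eqP => [eq|_]; last first.
  by move=> /IH[i im hi]; exists i => //; exact: ltnW.
subst q'; rewrite size_rcons leq_eqVlt => /predU1P[->|]; last first.
  by rewrite ltnS => /IH[i im hi]; exists i => //; exact: ltnW.
exists m => //; split; first by exists a.
by rewrite take_runS e -size_filter -/(moves_by _ _) moves_by_rcons eqxx size_rcons.
Qed.

Lemma nth_move_atE q n r i : nth_move_at q n r i ->
  size (moves_by q (take_run i.+1 r)) = n /\ size (moves_by q (take_run i r)) = n.-1.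
Proof.
case=> -[a ea]; rewrite -size_filter -/(moves_by _ _) => <-; split=> //.
by rewrite take_runS ea moves_by_rcons eqxx size_rcons.
Qed.

Definition submoves q r d : Prop :=
  forall i, exists j, prefix (moves_by q (take_run i r)) (moves_by q (take_run j d)).

Lemma player_movesP q r d :
  player_moves q r = player_moves q d <-> submoves q r d /\ submoves q d r.
Proof.
have pre r1 r2 : run_prefix (player_moves q r1) (player_moves q r2) <-> submoves q r1 r2.
  rewrite pmap_run_prefix.
  by split=> h i; have [j] := h i; exists j; move: p; rewrite !pmap_moves_by.
split=> [e|[/pre h1 /pre h2]]; last exact: run_prefix_anti.
by split; apply/pre; rewrite e => i; exists i; exact: prefix_refl.
Qed.

Lemma submoves_prefix q r d i j : submoves q r d ->
  size (moves_by q (take_run i r)) <= size (moves_by q (take_run j d)) ->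
  prefix (moves_by q (take_run i r)) (moves_by q (take_run j d)).
Proof.
move=> /(_ i)[k pk]; apply: (@prefix_size_le _ _ _ (moves_by q (take_run (maxn j k) d))).
  by apply: prefix_trans pk _; apply/prefix_moves_by/prefix_take_run; exact: leq_maxr.
by apply/prefix_moves_by/prefix_take_run; exact: leq_maxl.
Qed.

(** Matches a move of [r] with the move of [d] that has the same rank among the moves of [q]. *)
Lemma submoves_run_at q r d i a : submoves q r d -> submoves q d r ->
  run_at r i = Some (q, a) -> exists j,
    run_at d j = Some (q, a) /\ moves_by q (take_run j d) = moves_by q (take_run i r).
Proof.
move=> rd dr e.
have eS : moves_by q (take_run i.+1 r) = rcons (moves_by q (take_run i r)) (q, a).
  by rewrite take_runS e moves_by_rcons eqxx.
have [m /size_prefix] := rd i.+1; rewrite eS size_rcons => lem.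
have [//|j _ hj] := nth_move_exists _ lem.
have [ej _] := nth_move_atE hj; case: hj => -[b eb] _; exists j.
have : moves_by q (take_run j.+1 d) = moves_by q (take_run i.+1 r).
  apply: prefix_size_eq; last by rewrite ej eS size_rcons.
  by apply: submoves_prefix dr _; rewrite ej eS size_rcons.
by rewrite eS take_runS eb moves_by_rcons eqxx => /rcons_inj[-> ->].
Qed.

(** * Delays in terms of initial segments *)

(* Draw a run as a lattice path, one axis per player: [behind] says that [s] does
   not lie strictly on the wrong side of [t].  It is the same condition as
   [behind (~~ p) t s]. *)
Definition behind p s t : Prop :=
  prefix (moves_by p s) (moves_by p t) \/ prefix (moves_by (~~ p) t) (moves_by (~~ p) s).

Lemma delayP p d r :
  delay p d r <->
  [/\ forall q, submoves q d r, forall q, submoves q r d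
    & forall i j, behind p (take_run i d) (take_run j r)].
Proof.
split=> [[same lat]|[dr rd beh]]; last first.
  split=> [q|n k n0 k0]; first by apply/player_movesP.
  move=> [i [j [hi hj ltji]]].
  have [ei ei'] := nth_move_atE hi; have [ej ej'] := nth_move_atE hj.
  have [m /size_prefix] := rd p i.+1; rewrite ei => /(nth_move_exists n0)[i' _ hi'].
  have [m' /size_prefix] := rd (~~ p) j.+1; rewrite ej => /(nth_move_exists k0)[j' _ hj'].
  exists i', j'; split=> //; rewrite ltnNge; apply/negP => le.
  have [fi fi'] := nth_move_atE hi'; have [fj fj'] := nth_move_atE hj'.
  have lt : i' < j'.
    rewrite ltn_neqAle le andbT; apply/eqP => eij.
    case: hi' hj' => -[a ea] _ [[b eb] _].
    by move: eb; rewrite -eij ea => -[]; case: (p).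
  (* In [d], the segment ending with the [n]th [p]-move has fewer than [k] adversary moves; in [r],
     the segment just before the [n]th [p]-move has at least [k] of them and only [n.-1] [p]-moves.
     This violates [behind]. *)
  case: (beh i'.+1 i) => /size_prefix.
    by rewrite fi ei' leqNgt prednK // leqnn.
  apply/negP; rewrite -ltnNge.
  apply: (@leq_ltn_trans k.-1); first by rewrite -fj'; exact: size_moves_by_take_run.
  by rewrite prednK // -ej; exact: size_moves_by_take_run.
have dr q : submoves q d r by have /player_movesP[] := same q.
have rd q : submoves q r d by have /player_movesP[] := same q.
split=> // i j; apply: contrapT => nb.
have ltp : size (moves_by p (take_run j r)) < size (moves_by p (take_run i d)).
  by rewrite ltnNge; apply/negP => le; apply: nb; left; exact: submoves_prefix.
have ltq : size (moves_by (~~ p) (take_run i d)) < size (moves_by (~~ p) (take_run j r)).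
  by rewrite ltnNge; apply/negP => le; apply: nb; right; exact: submoves_prefix.
have n0 := leq_trans (ltn0Sn _) ltp; have k0 := leq_trans (ltn0Sn _) ltq.
have [m /size_prefix /(nth_move_exists n0)[i' _ hi']] := dr p i.
have [j' ltj hj'] := nth_move_exists k0 (leqnn _).
(* The ranks are those of the last [p]-move of the segment of [d] and the last adversary move of the
   segment of [r]. In [r] the former falls at or after [j], the latter before [j]. *)
have [i'' [j'' [hi'' hj'' lt'']]] : later d p (size (moves_by p (take_run i d)))
    (~~ p) (size (moves_by (~~ p) (take_run j r))).
  apply: lat => //; exists i', j'; split=> //; apply: (leq_trans ltj).
  rewrite leqNgt; apply/negP => lt; move: ltp; apply/negP; rewrite -leqNgt.
  have [<- _] := nth_move_atE hi'; exact: size_moves_by_take_run.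
have [_ ei''] := nth_move_atE hi''; have [ej'' _] := nth_move_atE hj''.
have lti : i'' < i.
  rewrite ltnNge; apply/negP => /(size_moves_by_take_run p d).
  by rewrite ei'' leqNgt prednK // leqnn.
move: ltq; rewrite -ej'' ltnNge => /negP; apply; apply: size_moves_by_take_run.
exact: leq_trans lt'' (ltnW lti).
Qed.

Lemma delayC p d r : delay p d r -> delay (~~ p) r d.
Proof.
move=> /delayP[dr rd beh]; apply/delayP; split=> // i j.
by rewrite /behind negbK; case: (beh j i); [right|left].
Qed.

Section LabelPreserving.

Variable g : labmove -> option labmove.
Hypothesis gP : forall l l', g l = Some l' -> l'.1 = l.1.

Lemma moves_by_pmap q s : moves_by q (pmap g s) = pmap g (moves_by q s).
Proof.
elim: s => //= l s IH; case e: (g l) => [l'|] /=; last first.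
  by rewrite IH; case: eqP => //= _; rewrite e.
by rewrite (gP e) IH; case: eqP => //= _; rewrite e.
Qed.

Lemma behind_pmap p s t : behind p s t -> behind p (pmap g s) (pmap g t).
Proof. by rewrite /behind !moves_by_pmap => -[]/(prefix_pmap g); [left|right]. Qed.

(** Since [g] keeps labels, it acts on each player's subsequence separately and so preserves the
    prefix relations in [delayP]. *)
Lemma delay_pmap_run p d r : delay p d r -> delay p (pmap_run g d) (pmap_run g r).
Proof.
have sub q r1 r2 : submoves q r1 r2 -> submoves q (pmap_run g r1) (pmap_run g r2).
  move=> h i; have [n ->] := take_pmap_runE g r1 i; have [j pj] := h n.
  have [k ek] := pmap_run_take g r2 j; exists k.
  by rewrite ek !moves_by_pmap prefix_pmap.
move=> /delayP[dr rd beh]; apply/delayP; split=> [q|q|i j]; try exact: sub.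
have [n ->] := take_pmap_runE g d i; have [m ->] := take_pmap_runE g r j.
exact: behind_pmap.
Qed.

End LabelPreserving.

(** * Legality *)

Lemma Lr_prefix A s t : prefix s t -> Lr A (Fin t) -> Lr A (Fin s).
Proof. by rewrite prefixE => /eqP <- /LrP/(_ (size s)). Qed.

Lemma illegal_byP A q r :
  illegal_by A q r <-> exists i a, [/\ run_at r i = Some (q, a),
    Lr A (Fin (take_run i r)) & ~ Lr A (Fin (rcons (take_run i r) (q, a)))].
Proof.
split=> [[n [s [a [e ls nl]]]]|[i [a [e ls nl]]]].
  by have [es ea] := take_runP e; exists (size s), a; rewrite es.
by exists i.+1, (take_run i r), a; rewrite take_runS e.
Qed.

Lemma first_illegal A r n : ~ Lr A (Fin (take_run n r)) ->
  exists i l, [/\ i < n, run_at r i = Some l, Lr A (Fin (take_run i r))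
    & ~ Lr A (Fin (rcons (take_run i r) l))].
Proof.
elim: n => [|n IH] nl.
  by case: nl; have -> : take_run 0 r = [::] by [case: r => [[]|]]; exact: Lr_nil.
have [ln|/IH[i [l [lin e li nli]]]] := pselect (Lr A (Fin (take_run n r))).
  move: nl; rewrite take_runS; case e: (run_at r n) => [l|] nl //.
  by exists n, l.
by exists i, l; split=> //; exact: ltnW.
Qed.

Lemma illegal_by_exists A r : ~ Lr A r -> exists q, illegal_by A q r.
Proof.
move=> nl; have [n /first_illegal[i [[q a] [_ e li nli]]]] :
    exists n, ~ Lr A (Fin (take_run n r)).
  by apply: contrapT => h; apply/nl/LrP => n; apply: contrapT => hn; apply: h; exists n.
by exists q; apply/illegal_byP; exists i, a.
Qed.

Lemma illegal_by_illegal A q r : illegal_by A q r -> ~ Lr A r.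
Proof.
by move=> [n [s [a [e _ nl]]]] /LrP/(_ n); rewrite e.
Qed.

(* [s], followed by those [p]-moves of [t] it does not contain yet, is a
   [p]-delay of [t]. *)
Definition lag p s t : Prop :=
  [/\ moves_by (~~ p) s = moves_by (~~ p) t, prefix (moves_by p s) (moves_by p t)
    & forall i j, behind p (take i s) (take j t)].

Lemma lag_pmap g p s t : (forall l l', g l = Some l' -> l'.1 = l.1) ->
  lag p s t -> lag p (pmap g s) (pmap g t).
Proof.
move=> gP [eq pr beh]; split=> [||i j]; rewrite ?moves_by_pmap ?eq ?prefix_pmap //.
have [n _ ->] := take_pmap g i s; have [m _ ->] := take_pmap g j t.
exact: behind_pmap.
Qed.

Lemma lag_mem p s t l : lag p s t -> l \in s -> l \in t.
Proof.
case=> eq /prefixP[u eu] _ ls.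
have [e|ne] := eqVneq l.1 p.
  have : l \in moves_by p t by rewrite eu mem_cat mem_filter e eqxx ls.
  by rewrite mem_filter => /andP[].
have : l \in moves_by (~~ p) t.
  by rewrite -eq mem_filter ls andbT; case: (l.1) (p) ne => [] [].
by rewrite mem_filter => /andP[].
Qed.

(* A legal move remains legal when the moves the adversary was late with are
   made before it. *)
Definition lag_legal A : Prop := forall p s t a,
  Lr A (Fin s) -> Lr A (Fin t) -> lag p s t ->
  Lr A (Fin (rcons s (~~ p, a))) -> Lr A (Fin (rcons t (~~ p, a))).

(* If the move were illegal after [t], then [p] would win
   [rcons t (~~ p, a)] no matter what it does next, in particular when it makes
   a move that is illegal in the delayed run. *)
Lemma static_lag_legal A : static A -> lag_legal A.
Proof.
move=> stA p s t a _ lt [eqs prs beh] lsa; apply: contrapT => nlta.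
have [u eu] := prefixP prs.
have pu : moves_by p u = u.
  have : all (fun l => l.1 == p) (moves_by p t) by exact: filter_all.
  by rewrite eu all_cat => /andP[_ /all_filterP].
(* [u] consists of the [p]-moves of [t] missing from [s]; they are made up for after the move
   [a]. *)
set x := rcons s (~~ p, a) ++ u.
(* If [x] is already illegal, any [b] will do. *)
have [b nlb] : exists b, ~ Lr A (Fin (rcons x (p, b))).
  have [/(@illegal_move_exists A _ p)//|nlx] := pselect (Lr A (Fin x)).
  by exists [::] => /(Lr_prefix (prefix_rcons _ _)).
set d := rcons x (p, b) in nlb; set r := rcons (rcons t (~~ p, a)) (p, b).
have npp : (~~ p == p) = false by case: (p).
have pnp : (p == ~~ p) = false by case: (p).
have qu : moves_by (~~ p) u = [::].
  by rewrite -pu /moves_by -filter_predI (@eq_filter _ _ pred0)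
       ?filter_pred0 // => l /=;
    case: (l.1) (p) => [] [].
have qd : moves_by (~~ p) d = moves_by (~~ p) (rcons s (~~ p, a)).
  by rewrite /d /x moves_by_rcons pnp moves_by_cat qu cats0.
have qr : moves_by (~~ p) r = moves_by (~~ p) d.
  by rewrite qd /r !moves_by_rcons /= pnp eqxx eqs.
have pd : moves_by p d = moves_by p r.
  by rewrite /d /x /r !moves_by_rcons moves_by_cat moves_by_rcons /= npp pu eu eqxx.
have wr : won_by A p (Fin r).
  right; exists (size t).+1, t, a; split=> //=.
  by rewrite /r -cats1 take_size_cat // size_rcons.
have dl : delay p (Fin d) (Fin r).
  have eqm q : moves_by q d = moves_by q r.
    by have [->//|] := eqVneq q p; case: (q) (p) qr pd => [] [].
  apply/delayP; split=> [q i|q i|i j] /=.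
  - by exists (size r); rewrite take_size -eqm; apply/prefix_moves_by/prefix_take.
  - by exists (size d); rewrite take_size eqm; apply/prefix_moves_by/prefix_take.
  have ed : d = s ++ (~~ p, a) :: rcons u (p, b).
    by rewrite /d /x rcons_cat cat_rcons.
  have er : r = t ++ [:: (~~ p, a); (p, b)] by rewrite /r -!cats1 -catA.
  (* Beyond [s], the segment of [d] contains all adversary moves of [r]; within [s], either [beh]
     applies or the segment of [r] contains all of [t]. *)
  have [lis|lsi] := leqP i (size s); last first.
    right; apply: (@prefix_trans _ (moves_by (~~ p) r)).
      by apply/prefix_moves_by/prefix_take.
    rewrite qr qd; apply: prefix_moves_by; apply: (@prefix_size_le _ _ _ d).
    - by rewrite /d /x rcons_cat prefix_prefix.
    - exact: prefix_take.
    - by rewrite size_rcons size_take_min leq_min lsi ed size_cat /= addnS ltnS leq_addr.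
  rewrite ed takel_cat //.
  have [ljt|ltj] := leqP j (size t); first by rewrite er takel_cat.
  left; apply: (@prefix_trans _ (moves_by p s)); first by apply/prefix_moves_by/prefix_take.
  apply: prefix_trans prs _; apply: prefix_moves_by; rewrite er.
  by rewrite take_cat ltnNge (ltnW ltj) prefix_prefix.
(* As [d] is illegal, [p] can win it only by an illegal adversary move. But [rcons s (~~ p, a)] is
   legal, and only [p] moves after it. *)
case: (stA _ _ _ wr dl) => [[]//|].
move=> /illegal_byP[i [c /= [ei _ nli]]].
have [lsi|lis] := leqP i (size s).
  apply: nli; apply: Lr_prefix lsa; apply: (@prefix_size_le _ _ _ d).
  - by have := take_runS (Fin d) i; rewrite /= ei => <-; exact: prefix_take.
  - by rewrite /d /x rcons_cat prefix_prefix.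
  - by rewrite !size_rcons size_take_min ltnS (leq_trans (geq_minl _ _)).
move: ei; rewrite /d /x -cats1 -catA onth_cat size_rcons ltnNge lis /= => ei.
have : (~~ p, c) \in u ++ [:: (p, b)] by apply/onthP; eexists; exact: ei.
rewrite mem_cat mem_seq1 xpair_eqE npp orbF => hc.
by have : (~~ p, c) \in moves_by (~~ p) u by [rewrite mem_filter eqxx]; rewrite qu.
Qed.

Lemma delay_lag p d r j a : delay p d r -> run_at r j = Some (~~ p, a) ->
  exists i, run_at d i = Some (~~ p, a) /\ lag p (take_run i d) (take_run j r).
Proof.
move=> /delayP[dr rd beh] ej.
have [i [ei eqm]] := submoves_run_at (rd _) (dr _) ej; exists i; split=> //.
split=> // [|k l].
  (* Taking [j.+1] adds the matched move to the segment of [r], which then has one adversary move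
     too many for the second alternative of [behind]. *)
  case: (beh i j.+1) => [|/size_prefix].
    by rewrite [take_run j.+1 r]take_runS ej moves_by_rcons /=; case: (p).
  by rewrite take_runS ej moves_by_rcons eqxx size_rcons eqm ltnn.
have tE r' m n : exists m', take m (take_run n r') = take_run m' r'.
  have [mn|nm] := leqP m n; first by exists m; rewrite take_take_run.
  by exists n; rewrite take_oversize // (leq_trans (size_take_run _ _)) // ltnW.
by have [k' ->] := tE d k i; have [l' ->] := tE r l j.
Qed.

(* If [d] became illegal by a move of [p] before reaching the offending move of
   [r], then by the symmetric argument that move would already be illegal in
   [r]. *)
Lemma illegal_by_delay G p d r :
  lag_legal G -> delay p d r -> illegal_by G (~~ p) r -> illegal_by G (~~ p) d.
Proof.
move=> lG dl /illegal_byP[j [a [ej lj nlj]]].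
have [i [ei lagi]] := delay_lag dl ej.
have [li|/first_illegal[k [[q b] [lki ek lk nlk]]]] := pselect (Lr G (Fin (take_run i d))).
  by apply/illegal_byP; exists i, a; split=> // /(lG _ _ _ _ li lj lagi).
have [eq|] := eqVneq q (~~ p).
  by subst q; apply/illegal_byP; exists k, b.
move=> qp; have eq : q = ~~ ~~ p by case: (q) (p) qp => [] [].
subst q; exfalso; have [m [em lagm]] := delay_lag (delayC dl) ek.
(* Before [i], [d] has no more [p]-moves than [r] has before [j], so the move matched with the
   illegal one lies in the legal part of [r]. *)
have ltmj : m < j.
  rewrite ltnNge; apply/negP => /(size_moves_by_take_run (~~ ~~ p) r).
  apply/negP; rewrite -ltnNge; case: (lagm) => -> _ _.
  apply: leq_trans (size_moves_by_move ek lki) _.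
  by rewrite negbK; case: lagi => _ /size_prefix.
have lS : Lr G (Fin (take_run m.+1 r)) by apply: Lr_prefix lj; exact: prefix_take_run.
apply: nlk; apply: lG lagm _ => //; first by apply: Lr_prefix lS; exact: prefix_take_run.
by move: lS; rewrite take_runS em.
Qed.

(** * Legality in the recurrence *)

Lemma dot_bits w : dot \notin map bit_char w.
Proof. by apply/mapP => -[[] _]. Qed.

Lemma node_move_inj w w' a a' :
  node_move w a = node_move w' a' -> w = w' /\ a = a'.
Proof.
elim: w w' => [|b w IH] [|b' w'] //=; first by case.
- by case: b'.
- by case: b.
- by case=> eb /IH[-> ->]; case: b b' eb => [] [].
Qed.

Lemma repl_move_neq_node u w a : repl_move u <> node_move w a.
Proof.
move=> e; have : dot \in repl_move u by rewrite e mem_cat mem_head orbT.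
by rewrite mem_rcons inE (negPf (dot_bits u)) orbF.
Qed.

Lemma RT_legal_repl A s q u :
  RT_legal_pos A s -> (q, repl_move u) \in s -> q = Environment.
Proof.
elim=> // {}s => [w _ IH _|w _ IH _|q' w a _ IH _ _];
  rewrite mem_rcons inE => /predU1P[|/IH//] -[// _].
by move=> /repl_move_neq_node.
Qed.

Lemma strip_lab_label v l l' : strip_lab v l = Some l' -> l'.1 = l.1.
Proof. by case: l => q m; rewrite /strip_lab /=; case: (strip v m) => //= b [<-]. Qed.

Lemma strip_bits v m : dot \notin m -> strip v m = None.
Proof.
move=> nd; case e: (strip v m) => [a|] //; case/stripP: e => n e.
by rewrite e mem_cat mem_head orbT in nd.
Qed.

(** A move at node [w] survives in thread [v] only if [v] extends [w]; the clause for
    non-replicative moves, taken at the tail of [v], then gives its legality. *)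
Lemma RT_legal_restrict A s v :
  RT_legal_pos A s -> Lr A (Fin (restrict_pos s v)).
Proof.
have skip t q m : dot \notin m -> restrict_pos (rcons t (q, m)) v = restrict_pos t v.
  by move=> nd; rewrite /restrict_pos -cats1 pmap_cat /= /strip_lab /= strip_bits // cats0.
elim=> [|{}s w _ IH _|{}s w _ IH _|{}s q w a _ IH _ la]; first exact: Lr_nil.
- by rewrite skip // dot_bits.
- by rewrite skip // mem_rcons inE negb_or dot_bits.
rewrite /restrict_pos -cats1 pmap_cat /= /strip_lab /=.
case e: (strip v (node_move w a)) => [b|] /=; last by rewrite cats0.
have [n /node_move_inj[ew eb]] := (stripP _ _ _).1 e; subst b.
have ev : v = cat_bits w (fun i => v (i + size w)).
  apply: funext => i; rewrite /cat_bits; case: ltnP => [|le]; last by rewrite subnK.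
  by rewrite ew size_mkseq => lin; rewrite nth_mkseq.
by rewrite cats1 ev; exact: la.
Qed.

Variant RT_step A s : player -> move -> Prop :=
| RT_step_switch w of actual_node s w : RT_step A s Environment (switch_move w)
| RT_step_repl w of outer_node s w : RT_step A s Environment (repl_move w)
| RT_step_nonrepl q w a of actual_node s w &
    (forall v, legal_move A (restrict_pos s (cat_bits w v)) q a) :
    RT_step A s q (node_move w a).

Lemma RT_legal_rcons A s q m : RT_legal_pos A (rcons s (q, m)) -> RT_step A s q m.
Proof.
move E: (rcons s (q, m)) => t lt; case: lt E => [|{}t w _ h|{}t w _ h|{}t q' w a _ h h'].
- by case: s.
- by move=> /rcons_inj[-> -> ->]; exact: RT_step_switch.
- by move=> /rcons_inj[-> -> ->]; exact: RT_step_repl.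
- by move=> /rcons_inj[-> -> ->]; exact: RT_step_nonrepl.
Qed.

Lemma actual_node_sub s t w : {subset s <= t} -> actual_node s w -> actual_node t w.
Proof.
move=> st [->|[u [b [q [-> us]]]]]; first by left.
by right; exists u, b, q; split=> //; exact: st.
Qed.

Lemma RT_lag_legal A : lag_legal A -> lag_legal (RT A).
Proof.
move=> lA p s t m /RT_Lr_Fin ls /RT_Lr_Fin lt lg /RT_Lr_Fin/RT_legal_rcons st.
apply/RT_Lr_Fin; have sub w : actual_node s w -> actual_node t w.
  by apply: actual_node_sub => l; exact: lag_mem lg.
(* Outerness is not monotone in the position, so a replicative move needs equal sets of nodes: nodes
   come from environment moves, which [s] and [t] share here. *)
have bus w : ~~ p = Environment -> actual_node t w -> actual_node s w.
  move=> ep [->|[u [b [q [-> ut]]]]]; first by left.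
  right; exists u, b, q; split=> //; move: (ut); rewrite (RT_legal_repl lt ut) => ut'.
  have : (Environment, repl_move u) \in moves_by (~~ p) t by rewrite mem_filter ep eqxx.
  by case: (lg) => <- _ _; rewrite mem_filter => /andP[].
case eqE: (~~ p) m / st => [w nw|w [nw out]|q w a nw la].
- by apply: RT_switch => //; exact: sub.
- apply: RT_repl => //; split; first exact: sub.
  by move=> [w' [/(bus _ eqE) nw' pw ne]]; apply: out; exists w'.
- subst q; apply: RT_nonrepl => // [|v]; first exact: sub.
  apply: lA (la v); try exact: RT_legal_restrict.
  by apply: lag_pmap lg; exact: strip_lab_label.
Qed.

(** * Winners in the recurrence *)

Lemma last_switch_finite r w : last_switch r w -> finitely_many_switches r.
Proof.
case=> [[_ no]|[n [_ no]]]; first by exists 0 => n u _; exact: no.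
by exists n.+1 => m u; exact: no.
Qed.

(** Being last among the switches depends only on the rank among the environment's moves, which
    matching preserves. *)
Lemma last_switch_submoves r d w :
  submoves Environment r d -> submoves Environment d r ->
  last_switch r w -> last_switch d w.
Proof.
move=> rd dr [[-> no]|[n [sn no]]]; [left|right].
  by split=> // n u /(submoves_run_at dr rd)[j [/no]].
have [j [ej mj]] := submoves_run_at rd dr sn; exists j; split=> // k u jk.
move=> /[dup] ek /(submoves_run_at dr rd)[i [ei mi]]; apply: (no i u _ ei).
rewrite ltnNge; apply/negP => /(size_moves_by_take_run Environment r); apply/negP.
by rewrite -ltnNge mi -mj; exact: size_moves_by_move ej jk.
Qed.

Lemma RT_won_by_env_delay A r d : static A ->
  delay Environment d r -> RT_won_by_env A r -> RT_won_by_env A d.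
Proof.
move=> stA dl [_ [w [lw win]]]; have /delayP[dr rd _] := dl.
have lw' := last_switch_submoves (rd _) (dr _) lw.
split; first exact: last_switch_finite lw'.
exists w; split=> //; apply: stA win _.
by apply: delay_pmap_run dl; exact: strip_lab_label.
Qed.

Lemma static_RT A : static A -> static (RT A).
Proof.
move=> stA p r d win dl; have lR := RT_lag_legal (static_lag_legal stA).
case: win => [[lr wr]|/(illegal_by_delay lR dl)]; last by right.
(* A [p]-illegal [d] would make the legal run [r] illegal, by the reversed delay. *)
have [ld|/illegal_by_exists[q]] := pselect (Lr (RT A) d); last first.
  have [->|qp] := eqVneq q (~~ p); first by right.
  have -> : q = ~~ ~~ p by case: (q) (p) qp => [] [].
  by move=> /(illegal_by_delay lR (delayC dl))/illegal_by_illegal.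
left; split=> //; move: wr; rewrite /= /RT_Wn.
(* For the machine the argument is contrapositive: [r] is an environment-delay of [d], so an
   environment win of [d] would pass to [r]. *)
case: p dl => dl; case: asboolP => wr; case: asboolP => wd //= _.
- by case: wr; exact: (RT_won_by_env_delay stA (delayC dl)).
- by case: wd; exact: (RT_won_by_env_delay stA dl).
Qed.

(** * Negation *)

Lemma moves_by_flip q s : moves_by q (map flip_label s) = map flip_label (moves_by (~~ q) s).
Proof.
rewrite /moves_by filter_map; congr map; apply: eq_filter => l /=.
by case: (l.1) q => [] [].
Qed.

Lemma prefix_flip s t : prefix s t -> prefix (map flip_label s) (map flip_label t).
Proof. by move=> /prefixP[u ->]; rewrite map_cat prefix_prefix. Qed.

Lemma delay_neg p d r : delay p d r -> delay (~~ p) (neg_run d) (neg_run r).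
Proof.
have sub q r1 r2 : submoves (~~ q) r1 r2 -> submoves q (neg_run r1) (neg_run r2).
  by move=> h i; have [j pj] := h i; exists j; rewrite !take_neg_run !moves_by_flip prefix_flip.
move=> /delayP[dr rd beh]; apply/delayP; split=> [q|q|i j]; try exact: sub.
rewrite /behind !take_neg_run !moves_by_flip negbK.
by case: (beh i j) => /prefix_flip; [left|right].
Qed.

Lemma neg_runK : involutive neg_run.
Proof.
case=> [s|f] /=; first by rewrite mapK //; exact: flip_labelK.
by congr Inf; apply: funext => n; rewrite /= flip_labelK.
Qed.

Lemma won_by_neg A p r : won_by (neg A) p r <-> won_by A (~~ p) (neg_run r).
Proof.
have ill q : illegal_by (neg A) q r <-> illegal_by A (~~ q) (neg_run r).
  split=> -[n [s [a [e ls nl]]]]; exists n, (map flip_label s), a; split.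
  - by rewrite take_neg_run e map_rcons.
  - exact: ls.
  - by move: nl; rewrite /= /neg_Lr /= map_rcons.
  - by rewrite -[r]neg_runK take_neg_run e map_rcons /flip_label /= negbK.
  - by rewrite /= /neg_Lr /= mapK //; exact: flip_labelK.
  - by rewrite /= /neg_Lr /= map_rcons mapK //; exact: flip_labelK.
rewrite /won_by ill /= /neg_Lr /neg_Wn.
split=> -[[lr w]|il]; first by left; split=> //; rewrite -w negbK.
- by right.
- by left; split=> //; rewrite w negbK.
- by right.
Qed.

(** Flipping labels swaps the winners and turns a [p]-delay into a [~~ p]-delay. *)
Lemma static_neg A : static A -> static (neg A).
Proof.
move=> stA p r d /won_by_neg win /delay_neg dl; apply/won_by_neg.
exact: stA win dl.
Qed.

Theorem theorem3p2 :
  forall A : game, static A -> static (RT A) /\ static (CT A).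
Proof.
move=> A stA; split; first exact: static_RT.
by apply/static_neg/static_RT/static_neg.
Qed.
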